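(* Let $x_0\in\mathbb{R}$ and suppose $d=\mathrm{dist}(x_0,\mathrm{supp}(d\mu))>0$. For each $n$ let $\delta_n = \dfrac{d^2}{d+\sqrt{2}\,a_{n+1}}$. Then either $p_n$ or $p_{n+1}$ (or both) has no zeros in $(x_0-\delta_n,x_0+\delta_n)$. In particular, if $a_\infty=\sup_n a_n<\infty$ and $\delta_\infty = \dfrac{d^2}{d+\sqrt{2}\,a_\infty}$, then $(x_0-\delta_\infty,x_0+\delta_\infty)$ does not contain zeros of $p_j$ for two successive values of $j$ (i.e. there is no $j$ such that both $p_j$ and $p_{j+1}$ have a zero in this interval).
   Context: $d\mu$ is a (positive) measure on $\mathbb{R}$ whose support is not a finite number of points and with $\int |x|^n\,d\mu(x)<\infty$ for all $n=0,1,2,\dots$. The orthonormal polynomials $p_n(x)=p_n(x;d\mu)$, $n=0,1,2,\dots$, are uniquely determined by $p_n(x)=\gamma_n x^n+\text{lower order}$ with $\gamma_n>0$, and $\int p_n(x)p_m(x)\,d\mu(x)=\delta_{nm}$. There are recursion coefficients $a_n>0$, $b_n\in\mathbb{R}$ for $n\ge 1$ such that $x p_n(x)=a_{n+1}p_{n+1}(x)+b_{n+1}p_n(x)+a_n p_{n-1}(x)$ for $n\ge 0$ (with the last term absent when $n=0$). *)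

(* Defs.v *)
From HB Require Import structures.
From mathcomp Require Import all_boot all_order all_algebra.
From mathcomp Require Import all_classical all_reals all_analysis.
Import Order.TTheory GRing.Theory Num.Theory.
Import numFieldNormedType.Exports.

Set Implicit Arguments.
Unset Strict Implicit.
Unset Printing Implicit Defensive.

Local Open Scope classical_set_scope.
Local Open Scope ring_scope.

Definition measure_support (R : realType)
    (mu : {measure set (measurableTypeR R) -> \bar R}) : set R :=
  [set x | forall U : set R, open_nbhs x U -> (0 < mu U)%E].

Definition finite_moments (R : realType)
    (mu : {measure set (measurableTypeR R) -> \bar R}) : Prop :=
  forall n : nat, (\int[mu]_x (`|x| ^+ n)%:E < +oo)%E.

(* [size (p n) = n.+1] says that [p n] has degree exactly [n], so that
   [lead_coef (p n)] is gamma_n.  The integrals are extended-real valued, hence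
   the last clause also rules out infinite ones. *)
Definition orthonormal_polynomials (R : realType)
    (mu : {measure set (measurableTypeR R) -> \bar R})
    (p : nat -> {poly R}) : Prop :=
  [/\ forall n, size (p n) = n.+1,
      forall n, 0 < lead_coef (p n) &
      forall n m,
        (\int[mu]_x ((p n).[x] * (p m).[x])%:E = ((n == m)%:R)%:E)%E].

(* The coefficients are indexed from 1: the values [a 0] and [b 0] are never
   used, and the recursion determines [a n] and [b n] for all [n >= 1]. *)
Definition recursion_coefficients (R : realType) (p : nat -> {poly R})
    (a b : nat -> R) : Prop :=
  (forall n, (1 <= n)%N -> 0 < a n) /\
  (forall n, 'X * p n = a n.+1 *: p n.+1 + b n.+1 *: p n
                        + (if n is m.+1 then a n *: p m else 0)).

Definition has_zero_in (R : realType) (q : {poly R}) (A : set R) : Prop :=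
  exists2 z, A z & root q z.

(* Main.v *)
(* Let K be the Christoffel-Darboux kernel at x0 of order n. Multiplication by
   x - x0 expands the L^2 norm by at least d, so the Christoffel-Darboux formula
   gives d^2 K(x0) <= a_{n+1}^2 (p_n(x0)^2 + p_{n+1}(x0)^2), which is at most
   2 a_{n+1}^2 p_m(x0)^2 for a suitable m in {n, n+1}. If z is a root of p_m at
   distance t < d from x0, then q = p_m / (x - z) has L^2 norm at most 1/(d - t)
   and degree at most n, so the reproducing property and Cauchy-Schwarz give
   p_m(x0)^2 = t^2 q(x0)^2 <= t^2 K(x0) / (d - t)^2. Combining both estimates
   yields d (d - t) <= sqrt 2 a_{n+1} t, that is, t >= delta_n. *)
Require Import Defs.
From HB Require Import structures.
From mathcomp Require Import all_boot all_order all_algebra.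
From mathcomp Require Import all_classical all_reals all_analysis.
From mathcomp Require Import measurable_realfun.
From mathcomp Require Import ring lra.
Import Order.TTheory GRing.Theory Num.Theory.
Import numFieldNormedType.Exports.
Local Open Scope classical_set_scope.
Local Open Scope ring_scope.

(** * The Christoffel-Darboux kernel, as a polynomial in one variable with the other fixed at [x] *)

Definition cd_kernel {R : realType} (p : nat -> {poly R}) (n : nat) (x : R) :
    {poly R} :=
  \sum_(j < n.+1) (p j).[x] *: p j.

(** Induction on [n]: cross-multiply the recursion for [p n.+1] with its value at [x] and subtract.
    The [b] terms cancel, and the [a n.+1] terms cancel the induction hypothesis. *)
Lemma christoffel_darboux {R : realType} (p : nat -> {poly R})
    (a b : nat -> R) (hab : recursion_coefficients p a b) (n : nat) (x : R) :
  ('X - x%:P) * cd_kernel p n x =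
    a n.+1 *: ((p n).[x] *: p n.+1 - (p n.+1).[x] *: p n).
Proof.
have [_ rec] := hab; rewrite /cd_kernel.
elim: n => [|n IHn].
  have := rec 0%N; rewrite addr0 => E.
  have := congr1 (horner^~ x) E; rewrite !hornerE => Ex.
  rewrite big_ord1 -!mul_polyC mulrCA mulrBl E -!mul_polyC.
  have : (x * (p 0%N).[x])%:P = (a 1%N * (p 1%N).[x] + b 1%N * (p 0%N).[x])%:P.
    by rewrite Ex.
  rewrite polyCD !polyCM => Ec.
  rewrite mulrBr [X in _ - X]mulrA [_%:P * x%:P]mulrC Ec; ring.
have := rec n.+1; rewrite /= => E.
have := congr1 (horner^~ x) E; rewrite !hornerE => Ex.
have : (x * (p n.+1).[x])%:P = (a n.+2 * (p n.+2).[x] +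
   b n.+2 * (p n.+1).[x] + a n.+1 * (p n).[x])%:P by rewrite Ex.
rewrite !polyCD !polyCM => Ec.
rewrite big_ord_recr mulrDr IHn -!mul_polyC mulrCA mulrBl E -!mul_polyC.
by rewrite (mulrBr _ _ (x%:P * _)) [X in _ + (_ - X)]mulrA
   [_%:P * x%:P]mulrC Ec; ring.
Qed.

Lemma graded_poly_ind {R : realType} (p : nat -> {poly R})
    (size_p : forall n, size (p n) = n.+1) (P : {poly R} -> Prop) (n : nat) :
  P 0 -> (forall (c : R) j q, (j < n)%N -> P q -> P (c *: p j + q)) ->
  forall q : {poly R}, (size q <= n)%N -> P q.
Proof.
move=> P0; elim: n => [_ q|n IHn Padd q sq].
  by rewrite leqn0 size_poly_eq0 => /eqP ->.
have lp : lead_coef (p n) != 0 by rewrite lead_coef_eq0 -size_poly_eq0 size_p.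
(* Subtracting [c *: p n] kills the coefficient of degree [n]; [c] may be zero, since [q] may have
   lower degree. *)
pose c := q`_n / lead_coef (p n).
rewrite -(subrK (c *: p n) q) addrC; apply: (Padd) => //.
apply: IHn => [c' j q' ltjn|]; first by apply: (Padd); exact: ltnW.
apply/leq_sizeP => j; rewrite leq_eqVlt => /predU1P[<-|ltnj].
  by rewrite coefB coefZ /c {1}lead_coefE size_p /= divfK ?subrr //
     -[X in _`_X]/(n.+1.-1) -(size_p n).
by rewrite coefB coefZ !nth_default ?mulr0 ?subrr ?size_p // (leq_trans sq).
Qed.

(** [L] stands for integration against the measure; keeping it abstract makes the argument
    algebraic. By linearity it suffices to test on each [p j], where orthonormality leaves a single
    term of the kernel. *)
Lemma cd_kernel_reproducing {R : realType} (p : nat -> {poly R})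
    (size_p : forall n, size (p n) = n.+1) (L : {scalar {poly R}})
    (orthL : forall n m, L (p n * p m) = (n == m)%:R)
    (n : nat) (x : R) (q : {poly R}) (sq : (size q <= n.+1)%N) :
  L (q * cd_kernel p n x) = q.[x].
Proof.
apply: (graded_poly_ind p size_p (fun q => L (q * _) = q.[x]) n.+1 _ _ q sq)
  => [|c j r ltjn IHr].
  by rewrite mul0r linear0 horner0.
rewrite mulrDl linearD IHr hornerD; congr (_ + _).
rewrite -scalerAl linearZ hornerZ; congr (_ * _).
rewrite mulr_sumr linear_sum (bigD1 (Ordinal ltjn)) //= -scalerAr linearZ /=.
rewrite orthL eqxx mulr1 big1 ?addr0 // => i ne_ij.
by rewrite -scalerAr linearZ /= orthL eq_sym
  (negbTE (ne_ij : (i : nat) != j)) mulr0.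
Qed.

Lemma size_cd_kernel {R : realType} (p : nat -> {poly R})
    (size_p : forall n, size (p n) = n.+1) (n : nat) (x : R) :
  (size (cd_kernel p n x) <= n.+1)%N.
Proof.
apply: (leq_trans (size_sum _ _ _)); apply/bigmax_leqP => i _.
by apply: (leq_trans (size_scale_leq _ _)); rewrite size_p.
Qed.

(** The diagonal value is a sum of squares whose first term comes from the nonzero constant
    [p 0]. *)
Lemma cd_kernel_diag_gt0 {R : realType} (p : nat -> {poly R})
    (size_p : forall n, size (p n) = n.+1) (n : nat) (x : R) :
  0 < (cd_kernel p n x).[x].
Proof.
rewrite /cd_kernel horner_sum big_ord_recl hornerZ /=.
have /size_poly1P[c c0 ->] : size (p 0%N) == 1 by rewrite size_p.
rewrite !hornerC ltr_wpDr ?sumr_ge0 // => [i _|].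
  by rewrite hornerZ -expr2 sqr_ge0.
by rewrite -expr2 exprn_even_gt0.
Qed.

Lemma cd_kernel_cauchy_schwarz {R : realType} (p : nat -> {poly R})
    (size_p : forall n, size (p n) = n.+1) (L : {scalar {poly R}})
    (orthL : forall n m, L (p n * p m) = (n == m)%:R)
    (L_ge0 : forall q : {poly R}, 0 <= L (q ^+ 2))
    (n : nat) (x : R) (q : {poly R}) (sq : (size q <= n.+1)%N) :
  q.[x] ^+ 2 <= L (q ^+ 2) * (cd_kernel p n x).[x].
Proof.
set K := cd_kernel p n x.
have K0 : 0 < K.[x] := cd_kernel_diag_gt0 p size_p n x.
have sK := size_cd_kernel p size_p n x.
(* By the reproducing property, [L] of this square equals [K.[x]] times the difference of the two
   sides of the goal. *)
have := L_ge0 (K.[x] *: q - q.[x] *: K).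
have -> : (K.[x] *: q - q.[x] *: K) ^+ 2 =
    K.[x] ^+ 2 *: q ^+ 2 - (2 * K.[x] * q.[x]) *: (q * K)
      + q.[x] ^+ 2 *: (K * K).
  by rewrite -!mul_polyC !(polyC_exp, polyCM); ring.
rewrite linearD linearB !(scalarZ L) /=.
rewrite !(cd_kernel_reproducing p size_p L orthL) // => H.
rewrite -(ler_pM2l K0); nra.
Qed.

(** The hypothesis [L_ge0] encodes that the measure has no mass at distance less than [d] from
    [x]. *)
Lemma cd_kernel_diag_le {R : realType} (p : nat -> {poly R})
    (size_p : forall n, size (p n) = n.+1) (L : {scalar {poly R}})
    (orthL : forall n m, L (p n * p m) = (n == m)%:R)
    (a b : nat -> R) (hab : recursion_coefficients p a b) (x d : R)
    (d_ge0 : 0 <= d)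
    (L_ge0 : forall q : {poly R},
      (forall y, d <= `|y - x| -> 0 <= q.[y]) -> 0 <= L q) (n : nat) :
  d ^+ 2 * (cd_kernel p n x).[x] <=
    a n.+1 ^+ 2 * ((p n).[x] ^+ 2 + (p n.+1).[x] ^+ 2).
Proof.
have sK := size_cd_kernel p size_p n x.
have CD := christoffel_darboux p a b hab n x.
have KK := cd_kernel_reproducing p size_p L orthL n x _ sK.
set K := cd_kernel p n x in sK CD KK *.
have LCD : L ((('X - x%:P) * K) ^+ 2) =
    a n.+1 ^+ 2 * ((p n).[x] ^+ 2 + (p n.+1).[x] ^+ 2).
  rewrite CD; set u := (p n).[x]; set v := (p n.+1).[x].
  have -> : (a n.+1 *: (u *: p n.+1 - v *: p n)) ^+ 2 = a n.+1 ^+ 2 *: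
      (u ^+ 2 *: (p n.+1 * p n.+1) - (2 * u * v) *: (p n * p n.+1)
       + v ^+ 2 *: (p n * p n)).
    by rewrite -!mul_polyC !(polyC_exp, polyCM); ring.
  rewrite (scalarZ L) /= linearD linearB !(scalarZ L) /= !orthL !eqxx.
  by rewrite (ltn_eqF (ltnSn n)) mulr0 !mulr1 subr0 addrC.
have : 0 <= L ((('X - x%:P) * K) ^+ 2 - d ^+ 2 *: (K * K)).
  apply: L_ge0 => y dy.
  have -> : ((('X - x%:P) * K) ^+ 2 - d ^+ 2 *: (K * K)).[y] =
      ((y - x) ^+ 2 - d ^+ 2) * K.[y] ^+ 2 by rewrite !hornerE /=; ring.
  rewrite mulr_ge0 ?sqr_ge0 // subr_ge0.
  by rewrite -[leRHS]real_normK ?num_real // ler_sqr ?nnegrE.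
by rewrite linearB (scalarZ L) /= KK LCD subr_ge0.
Qed.

(** * Distance from [x] to a root *)

Lemma orthonormal_root_le {R : realType} (p : nat -> {poly R})
    (size_p : forall n, size (p n) = n.+1) (L : {scalar {poly R}})
    (orthL : forall n m, L (p n * p m) = (n == m)%:R) (x d : R)
    (L_ge0 : forall q : {poly R},
      (forall y, d <= `|y - x| -> 0 <= q.[y]) -> 0 <= L q)
    (n m : nat) (le_mn : (m <= n.+1)%N) (z : R) (z_near : `|z - x| <= d)
    (root_z : root (p m) z) :
  (d - `|z - x|) ^+ 2 * (p m).[x] ^+ 2 <=
    `|z - x| ^+ 2 * (cd_kernel p n x).[x].
Proof.
have [q Eq] := factor_theorem _ _ root_z.
(* Dividing out the root lowers the degree by one, so even for [m = n.+1] the kernel of order [n]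
   reproduces [q]. *)
have sq : (size q <= n.+1)%N.
  have q0 : q != 0.
    by apply: contra_eq_neq Eq => ->; rewrite mul0r -size_poly_eq0 size_p.
  have := size_p m.
  by rewrite Eq size_Mmonic ?monicXsubC // size_XsubC addn2 /= => -[->].
have L_sqr_ge0 (r : {poly R}) : 0 <= L (r ^+ 2).
  by apply: L_ge0 => y _; rewrite hornerE sqr_ge0.
have CS := cd_kernel_cauchy_schwarz p size_p L orthL L_sqr_ge0 n x q sq.
have K0 := cd_kernel_diag_gt0 p size_p n x.
set t := `|z - x| in z_near *.
(* Where [|y - x|] is at least [d], the triangle inequality gives [|y - z| >= d - t]; the bound 1 is
   [L (p m * p m)]. *)
have Lq : (d - t) ^+ 2 * L (q ^+ 2) <= 1.
  have : 0 <= L (p m * p m - (d - t) ^+ 2 *: q ^+ 2).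
    apply: L_ge0 => y dy; rewrite Eq.
    have -> : ((q * ('X - z%:P)) * (q * ('X - z%:P)) -
        (d - t) ^+ 2 *: q ^+ 2).[y] =
      ((y - z) ^+ 2 - (d - t) ^+ 2) * q.[y] ^+ 2 by rewrite !hornerE /=; ring.
    rewrite mulr_ge0 ?sqr_ge0 // subr_ge0.
    rewrite -[leRHS]real_normK ?num_real // ler_sqr ?nnegrE ?subr_ge0 //.
    have := ler_distD z y x; rewrite -/t; lra.
  by rewrite linearB (scalarZ L) /= orthL eqxx subr_ge0.
rewrite Eq hornerM hornerXsubC exprMn -[(x - z) ^+ 2]real_normK ?num_real //.
rewrite distrC -/t.
rewrite [leLHS](_ : _ = t ^+ 2 * ((d - t) ^+ 2 * q.[x] ^+ 2)); last by ring.
rewrite ler_wpM2l ?sqr_ge0 //.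
apply: (le_trans (ler_wpM2l (sqr_ge0 _) CS)).
by rewrite mulrA ger_pMl.
Qed.

Lemma orthonormal_root_far {R : realType} (p : nat -> {poly R})
    (size_p : forall n, size (p n) = n.+1) (L : {scalar {poly R}})
    (orthL : forall n m, L (p n * p m) = (n == m)%:R)
    (a b : nat -> R) (hab : recursion_coefficients p a b) (x d : R)
    (d_gt0 : 0 < d)
    (L_ge0 : forall q : {poly R},
      (forall y, d <= `|y - x| -> 0 <= q.[y]) -> 0 <= L q)
    (n m : nat) (le_mn : (m <= n.+1)%N)
    (m_max : (p n).[x] ^+ 2 + (p n.+1).[x] ^+ 2 <= 2 * (p m).[x] ^+ 2)
    (z : R) (root_z : root (p m) z) :
  d ^+ 2 / (d + Num.sqrt 2 * a n.+1) <= `|z - x|.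
Proof.
have a0 : 0 < a n.+1 by case: hab => + _; apply.
set s := Num.sqrt 2 : R; have s0 : 0 < s by rewrite sqrtr_gt0.
have s2 : s ^+ 2 = 2 by rewrite sqr_sqrtr.
have sa0 := mulr_gt0 s0 a0.
have D0 : 0 < d + s * a n.+1 by rewrite addr_gt0.
rewrite ler_pdivrMr //.
(* A root at distance at least [d] is far enough, because the claimed bound is below [d]. *)
have [dz|zd] := leP d `|z - x|; first by nra.
have K0 := cd_kernel_diag_gt0 p size_p n x.
have B1 := cd_kernel_diag_le p size_p L orthL a b hab x d (ltW d_gt0) L_ge0 n.
have B2 := orthonormal_root_le p size_p L orthL x d L_ge0 n m le_mn z
  (ltW zd) root_z.
have := normr_ge0 (z - x); set t : R := `|z - x| in zd B2 * => t0.
set K := (cd_kernel p n x).[x] in K0 B1 B2.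
set P := (p m).[x] ^+ 2 in m_max B2.
set S := _ + _ in B1 m_max.
have a2 : 0 < a n.+1 ^+ 2 by rewrite exprn_gt0.
have B3 : d ^+ 2 * K <= 2 * a n.+1 ^+ 2 * P.
  have := ler_wpM2l (ltW a2) m_max; lra.
(* Positivity of the kernel on the diagonal prevents [(p m).[x]] from vanishing, so that [P] can be
   cancelled below. *)
have P0 : 0 < P.
  have : 0 < d ^+ 2 * K by rewrite mulr_gt0 ?exprn_gt0.
  by move/lt_le_trans => /(_ _ B3); rewrite pmulr_rgt0 // mulr_gt0.
have B4 : (d * (d - t)) ^+ 2 * P <= (s * a n.+1 * t) ^+ 2 * P.
  have := ler_wpM2l (sqr_ge0 d) B2; have := ler_wpM2l (sqr_ge0 t) B3.
  rewrite !exprMn s2; lra.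
have : d * (d - t) <= s * a n.+1 * t.
  rewrite -ler_sqr ?nnegrE; first by rewrite ler_pM2r in B4.
    by apply: mulr_ge0; rewrite ?subr_ge0 ltW.
  by rewrite mulr_ge0 // ltW.
lra.
Qed.

(** * Integration against [mu] as a functional positive off the ball *)

(* Lindelof: cover [U] by the null balls with rational centre and radius. *)
Lemma measure_open_disjoint_support {R : realType}
    (mu : {measure set (measurableTypeR R) -> \bar R}) (U : set R)
    (oU : open U) (dU : U `&` measure_support mu = set0) : mu U = 0%E.
Proof.
pose B (i : rat * rat) : set R := ball (ratr i.1 : R) (ratr i.2).
(* Codes of no pair and balls of nonzero measure are sent to the empty set, so every [F k] is
   negligible. *)
pose F k : set R := if unpickle k is Some i then
  if `[< mu (B i) = 0%E >] then B i else set0 else set0.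
have Fnull k : mu.-negligible (F k : set (measurableTypeR R)).
  rewrite /F; case: unpickle => [i|]; last exact: negligible_set0.
  case: asboolP => Bi0; last exact: negligible_set0.
  by apply/negligibleP => //; exact: measurable_ball.
apply/negligibleP; first exact: open_measurable.
apply: negligibleS (negligible_bigcup Fnull) => x Ux.
have [V [oV Vx] V0] : exists2 V, open_nbhs x V & mu V = 0%E.
  have Nx : ~ measure_support mu x by move=> Sx; rewrite -[False]/(set0 x) -dU.
  move/existsNP : Nx => [V /not_implyP[Vx /negP]]; rewrite -leNgt => V0.
  by exists V => //; apply/eqP; rewrite -measure_le0.
have [e /= e0 eV] := (nbhs_ballP x V).1 (open_nbhs_nbhs (conj oV Vx)).
(* With [r < e / 2] and the centre within [r] of [x], the rational ball contains [x] and stays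
   inside [ball x e], hence inside [V]. *)
have [r] := @rat_in_itvoo R 0 (e / 2) (divr_gt0 e0 (ltr0n _ 2)).
rewrite in_itv /= => /andP[r0 re].
have [c] := @rat_in_itvoo R (x - ratr r) (x + ratr r) ltac:(lra).
rewrite in_itv /= => /andP[cl cr].
exists (pickle (c, r)); first exact: I.
rewrite /F pickleK; case: asboolP => [_|[]].
  by rewrite /B -ball_normE /= ltr_norml; lra.
apply: (@subset_measure0 _ _ _ mu _ V) => //.
- exact: measurable_ball.
- exact: open_measurable.
apply: subset_trans eV => y; rewrite /B -!ball_normE /= => ych.
have : `|x - ratr c| < ratr r by rewrite ltr_norml; lra.
have := ler_distD (ratr c) x y; lra.
Qed.

Lemma measure_ball_edist_inf {R : realType}
    (mu : {measure set (measurableTypeR R) -> \bar R}) (x d : R)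
    (dist_x : edist_inf (measure_support mu) x = d%:E) :
  mu (ball x d) = 0%E.
Proof.
apply: measure_open_disjoint_support; first exact: ball_open.
rewrite -subset0 => y [xy Sy] /=.
have : (edist_inf (measure_support mu) x <= edist (x, y))%E.
  by apply: ereal_inf_lbound; exists y.
rewrite dist_x leNgt => /negP; apply.
move: xy; rewrite -ball_normE /= => xy.
(* The midpoint turns membership in an open ball into a bound on [edist] that is still strictly
   below [d]. *)
pose r := (`|x - y| + d) / 2.
have r0 : 0 < r by have := normr_ge0 (x - y); rewrite /r; lra.
apply: (@le_lt_trans _ _ r%:E); last by rewrite lte_fin /r; lra.
by apply: edist_fin => //=; rewrite -ball_normE /= /r; lra.
Qed.

Lemma integrable_horner {R : realType}
    (mu : {measure set (measurableTypeR R) -> \bar R})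
    (moments : finite_moments mu) (q : {poly R}) :
  mu.-integrable setT (EFin \o horner q : measurableTypeR R -> \bar R).
Proof.
have -> : (EFin \o horner q) =
    (fun x => \sum_(i < size q) ((q`_i)%:E * (x ^+ i)%:E)%E).
  by apply/funext => x /=; rewrite horner_coef -sumEFin; apply: eq_bigr => i _.
apply: integrable_sum => // i _; apply: integrableZl => //.
apply/integrableP; split.
  by apply/measurable_EFinP; exact: measurable_funX.
by under eq_integral do rewrite /= normrX; exact: moments.
Qed.

Lemma Rintegral_horner_linear {R : realType}
    (mu : {measure set (measurableTypeR R) -> \bar R})
    (moments : finite_moments mu) :
  scalar (fun q : {poly R} => \int[mu]_x q.[x]).
Proof.
have int q := @integrable_horner R mu moments q.
move=> c q r /=; under eq_Rintegral do rewrite hornerD hornerZ.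
rewrite RintegralD ?RintegralZl //.
by apply: eq_integrable (int (c *: q)) => // x _ /=; rewrite hornerZ.
Qed.

(** This supplies the positivity assumed of [L] above: the ball is null, so removing it from the
    domain does not change the integral. *)
Lemma Rintegral_horner_ge0 {R : realType}
    (mu : {measure set (measurableTypeR R) -> \bar R})
    (moments : finite_moments mu) (x d : R)
    (dist_x : edist_inf (measure_support mu) x = d%:E) (q : {poly R})
    (q_ge0 : forall y, d <= `|y - x| -> 0 <= q.[y]) :
  0 <= \int[mu]_x q.[x].
Proof.
rewrite /Rintegral (@negligible_integral _ _ _ mu _ (ball x d)) //.
- apply: Rintegral_ge0 => y [_ xy]; apply: q_ge0; rewrite leNgt distrC.
  by apply/negP => yx; apply: xy; rewrite -ball_normE.
- exact: measurable_ball.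
- exact: integrable_horner.
- exact: measure_ball_edist_inf.
Qed.

(** * Zeros of two consecutive orthonormal polynomials *)

Theorem theorem1 (R : realType)
    (mu : {measure set (measurableTypeR R) -> \bar R})
    (supp_infinite : infinite_set (measure_support mu))
    (moments : finite_moments mu)
    (p : nat -> {poly R}) (hp : orthonormal_polynomials mu p)
    (a b : nat -> R) (hab : recursion_coefficients p a b)
    (x0 d : R) (dist_x0 : edist_inf (measure_support mu) x0 = d%:E)
    (d_gt0 : 0 < d) :
  (forall n : nat,
     let delta := d ^+ 2 / (d + Num.sqrt 2 * a n.+1) in
     ~ has_zero_in (p n) `]x0 - delta, x0 + delta[%classic \/
     ~ has_zero_in (p n.+1) `]x0 - delta, x0 + delta[%classic) /\
  (let A := [set a n | n in [set n : nat | (1 <= n)%N]] in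
   has_ubound A ->
   let delta_inf := d ^+ 2 / (d + Num.sqrt 2 * sup A) in
   ~ exists j : nat,
       has_zero_in (p j) `]x0 - delta_inf, x0 + delta_inf[%classic /\
       has_zero_in (p j.+1) `]x0 - delta_inf, x0 + delta_inf[%classic).
Proof.
have [size_p _ orth] := hp; have [a_gt0 _] := hab.
pose L : {scalar {poly R}} := HB.pack (fun q : {poly R} => \int[mu]_x q.[x])
  (GRing.isLinear.Build _ _ _ _ _ (Rintegral_horner_linear mu moments)).
have orthL i j : L (p i * p j) = (i == j)%:R.
  have -> : (i == j)%:R = fine ((i == j)%:R%:E : \bar R) by [].
  rewrite -(orth i j) /L /= /Rintegral; congr fine.
  by apply: eq_integral => x _; rewrite hornerM.
have L_ge0 (q : {poly R}) :
    (forall y, d <= `|y - x0| -> 0 <= q.[y]) -> 0 <= L q.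
  exact: Rintegral_horner_ge0.
have no_common n : let delta := d ^+ 2 / (d + Num.sqrt 2 * a n.+1) in
    ~ has_zero_in (p n) `]x0 - delta, x0 + delta[%classic \/
    ~ has_zero_in (p n.+1) `]x0 - delta, x0 + delta[%classic.
  move=> delta.
  have free m : (m <= n.+1)%N ->
      (p n).[x0] ^+ 2 + (p n.+1).[x0] ^+ 2 <= 2 * (p m).[x0] ^+ 2 ->
      ~ has_zero_in (p m) `]x0 - delta, x0 + delta[%classic.
    move=> le_mn m_max [z /=]; rewrite in_itv /= => z_in root_z.
    have := orthonormal_root_far p size_p L orthL a b hab x0 d d_gt0 L_ge0
      n m le_mn m_max z root_z.
    by rewrite leNgt ltr_distl z_in.
  (* The index to choose is the one whose polynomial is larger in absolute value at [x0]. *)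
  by have [le|/ltW le] := leP ((p n).[x0] ^+ 2) ((p n.+1).[x0] ^+ 2);
    [right|left]; apply: free => //; lra.
split=> [//|A ubA delta_inf [j [zero_j zero_Sj]]].
have a_le_sup : a j.+1 <= sup A by apply: ub_le_sup => //; exists j.+1.
(* The radius decreases in the recursion coefficient, so the interval for the supremum lies inside
   the one for [a j.+1]. *)
have delta_le : delta_inf <= d ^+ 2 / (d + Num.sqrt 2 * a j.+1).
  have s0 : 0 <= Num.sqrt 2 :> R := sqrtr_ge0 2.
  have aj := a_gt0 j.+1 isT.
  rewrite ler_wpM2l ?sqr_ge0 // lef_pV2 ?posrE; first 1 last.
  - by rewrite ltr_wpDr // mulr_ge0 // (le_trans (ltW aj)).
  - by rewrite ltr_wpDr // mulr_ge0 // ltW.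
  by rewrite lerD2l ler_wpM2l.
have widen (q : {poly R}) :
    has_zero_in q `]x0 - delta_inf, x0 + delta_inf[%classic ->
    has_zero_in q `]x0 - d ^+ 2 / (d + Num.sqrt 2 * a j.+1),
                    x0 + d ^+ 2 / (d + Num.sqrt 2 * a j.+1)[%classic.
  move=> [z /= z_in root_z]; exists z => //=; move: z_in.
  by rewrite !in_itv /= -!ltr_distl => /lt_le_trans; apply.
by case: (no_common j); apply; exact: widen.
Qed.
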